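(* Let $I\subseteq P=\Bbbk[x_1,\dots,x_n]$ be a non-zero homogeneous ideal and let $H$ be a homogeneous Pommaret basis of $I$ for a class respecting term order. Let $d=\min_{h\in H}\mathrm{cls}\,h$. Then the variables $(x_1,\dots,x_d)$ form a maximal $I$-regular sequence and thus $\mathrm{depth}\,I=d$.
   Context: $\Bbbk$ is a field. The class of $\mu\in\mathbb{N}_0^n$ is $\mathrm{cls}\,\mu=\min\{i\mid\mu_i\ne0\}$, with $\mathrm{cls}\,0=n$; for $f\neq0$, $\mathrm{cls}\,f$ is the class of the leading exponent $\mathrm{le}_\prec f$. A term order $\prec$ is class respecting if for multi indices with $|\mu|=|\nu|$ (same total degree) $\mathrm{cls}\,\mu<\mathrm{cls}\,\nu$ implies $\mu\prec\nu$ (so on terms of equal degree it is the reverse lexicographic order: $\mu\prec\nu$ iff the first non-vanishing entry of $\mu-\nu$ is positive). The Pommaret cone of $\mu$ is $C_P(\mu)=\{\mu+\rho\mid\rho_j=0\text{ for all }j>\mathrm{cls}\,\mu\}$. A Pommaret basis of $I$ for $\prec$ is a finite set $H\subset I\setminus\{0\}$ with pairwise distinct leading exponents such that $\mathrm{le}_\prec I=\{\mathrm{le}_\prec f\mid0\ne f\in I\}$ is the disjoint union of the cones $C_P(\mathrm{le}_\prec h)$, $h\in H$; it is homogeneous if all its elements are. For a finitely generated graded $P$-module $M$, a sequence $(f_1,\dots,f_r)$ of homogeneous polynomials of positive degree is $M$-regular if $f_1$ is a non zero divisor on $M$ and each $f_i$ is a non zero divisor on $M/\langle f_1,\dots,f_{i-1}\rangle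 M$. It is maximal if it cannot be extended to a longer $M$-regular sequence of this kind. The depth of $M$ is the maximal length of an $M$-regular sequence. Here the ideal $I$ itself is considered as the $P$-module $M$. *)

(* Defs.v *)
From mathcomp Require Import all_boot all_order all_algebra.
From mathcomp Require Import finmap mpoly.

Set Implicit Arguments.
Unset Strict Implicit.
Unset Printing Implicit Defensive.

Import GRing.Theory.
Local Open Scope ring_scope.

(* Variables are numbered from 1 in the mathematics and from 0 in 'I_n, so
   x_j corresponds to 'X_i with j = i.+1; classes are 1-based. *)

Section TermOrders.
Variable n : nat.
Implicit Types (le : rel 'X_{1..n}) (m rho : 'X_{1..n}).

Definition term_order le : Prop :=
  [/\ total le, antisymmetric le, transitive le,
      forall m1 m2 m, le m1 m2 -> le (m1 + m)%MM (m2 + m)%MM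
    & forall m, le 0%MM m].

Definition term_lt le m1 m2 : bool := (m1 != m2) && le m1 m2.

(* The default value n of the minimum gives mcls 0 = n and is otherwise
   harmless, every other term being at most n. *)
Definition mcls m : nat := \big[minn/n]_(i < n | m i != 0%N) i.+1.

Definition class_respecting le : Prop :=
  forall m1 m2, mdeg m1 = mdeg m2 -> (mcls m1 < mcls m2)%N -> term_lt le m1 m2.

Definition pommaret_cone m m' : Prop :=
  exists2 rho : 'X_{1..n}, (forall j : 'I_n, (mcls m < j.+1)%N -> rho j = 0%N)
             & m' = (m + rho)%MM.

End TermOrders.

Section Polynomials.
Variables (k : fieldType) (n : nat).
Local Notation P := {mpoly k[n]}.
Implicit Types (le : rel 'X_{1..n}) (f h : P) (I : P -> Prop) (H : {fset P}).

(* The le-largest monomial of f; 0 when f = 0. The library's mlead is the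
   leading monomial for one fixed order only. *)
Definition lexp le f : 'X_{1..n} :=
  foldr (fun m1 m2 => if le m1 m2 then m2 else m1) 0%MM (msupp f).

Lemma lexpP le f : term_order le -> f != 0 ->
  lexp le f \in msupp f /\ {in msupp f, forall m, le m (lexp le f)}.
Proof.
case=> le_total le_anti le_trans _ le0; rewrite -msupp_eq0 /lexp.
elim: (msupp f) => //= m [|m' s] IHs _.
  have /= le_m0 : le m 0%MM -> m = 0%MM by move=> h; apply: le_anti; rewrite h le0.
  by case: ifP => [/le_m0 ->|_]; split=> [|x]; rewrite !inE // => /eqP ->;
     case/orP: (le_total 0%MM 0%MM); case/orP: (le_total m m).
have [] := IHs isT; set b := foldr _ _ _ => b_in b_max.
case: ifP => [le_mb|nle_mb]; split; rewrite ?inE ?eqxx //.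
- by rewrite -in_cons b_in orbT.
- by move=> x; rewrite inE => /predU1P[->|/b_max].
have le_bm : le b m by have := le_total m b; rewrite nle_mb.
move=> x; rewrite inE => /predU1P[->|/b_max le_xb].
  by case/orP: (le_total m m).
exact: le_trans le_xb le_bm.
Qed.

Definition pcls le f : nat := mcls (lexp le f).

Definition is_ideal I : Prop :=
  [/\ I 0, forall f g, I f -> I g -> I (f + g)
    & forall a f, I f -> I (a * f)].

Definition homogeneous_ideal I : Prop :=
  is_ideal I /\ forall f d, I f -> I (pihomog mdeg d f).

Definition lexp_ideal le I (m : 'X_{1..n}) : Prop :=
  exists f, [/\ I f, f != 0 & lexp le f = m].

Definition pommaret_basis le I H : Prop :=
  [/\ forall h, h \in H -> I h /\ h != 0,
      {in H &, injective (lexp le)},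
      forall m, lexp_ideal le I m <->
                exists2 h, h \in H & pommaret_cone (lexp le h) m
    & forall h1 h2 m, h1 \in H -> h2 \in H ->
        pommaret_cone (lexp le h1) m -> pommaret_cone (lexp le h2) m ->
        h1 = h2].

(* The default value n is only reached for H = fset0, as classes are at
   most n. *)
Definition min_cls le H : nat := \big[minn/n]_(h <- H) pcls le h.

(* Modules over P are represented as submodules M (given by their membership
   predicate) of some lmodType over P; an ideal is a submodule of P^o. *)
Section Regular.
Variable V : lmodType P.
Implicit Types (M N : V -> Prop) (fs gs : seq P).

(* The submodule <f_1, ..., f_r> M of M. *)
Definition seq_mul fs M : V -> Prop := fun v =>
  exists2 w : 'I_(size fs) -> V, (forall i, M (w i))
                               & v = \sum_(i < size fs) fs`_i *: w i.

(* f is a non zero divisor on the quotient M / N. *)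
Definition nonzerodivisor_quo f M N : Prop :=
  forall v, M v -> N (f *: v) -> N v.

(* For i = 0 the submodule seq_mul [::] M is zero. As msize is the degree plus
   one, 1 < msize says that the degree is positive. *)
Definition regular_seq M fs : Prop :=
  forall i, (i < size fs)%N ->
    [/\ fs`_i \is homog mdeg, (1 < msize fs`_i)%N
      & nonzerodivisor_quo fs`_i M (seq_mul (take i fs) M)].

Definition maximal_regular_seq M fs : Prop :=
  regular_seq M fs /\ forall gs, regular_seq M (fs ++ gs) -> gs = [::].

(* depth M = d; a relation, since the lengths may be unbounded when M = 0. *)
Definition has_depth M (d : nat) : Prop :=
  (exists2 fs, regular_seq M fs & size fs = d) /\
  forall fs, regular_seq M fs -> (size fs <= d)%N.

End Regular.

(* x_1, ..., x_d, for d <= n. *)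
Definition first_vars (d : nat) : seq P :=
  [seq 'X_i | i : 'I_n <- enum 'I_n & (i < d)%N].

End Polynomials.

(* Main.v *)
(* Each v in I has a unique representation v = sum_h p_h h over h in H with p_h
   in k[x_1,...,x_cls(h)]: the leading exponents of the summands lie in disjoint
   cones and cannot cancel. All classes being at least d, I is therefore a free
   module over k[x_1,...,x_d], so x_1,...,x_d is I-regular.
   Let h0 have maximal degree among the elements of H of class d. As the order
   is class respecting, x_j h0 has, for j > d, a representation all of whose
   terms have class at most d; by the maximality of deg h0 each of its
   coefficients p_h lies in <x_1,...,x_d>. Hence h0 represents a nonzero socle
   element of I/<x_1,...,x_d>I.
   A socle element modulo a regular sequence of length d yields a nonzero class
   of degree d in the Koszul cohomology H(x_1,...,x_n; I), whereas an I-regular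
   sequence of length r makes this cohomology vanish in degrees below r. So no
   I-regular sequence is longer than d, which also gives maximality. *)
From HB Require Import structures.
Require Import Defs.
From mathcomp Require Import all_boot all_order all_algebra.
From mathcomp Require Import finmap mpoly.

Import GRing.Theory.
Local Open Scope ring_scope.

Set Implicit Arguments.
Unset Strict Implicit.
Unset Printing Implicit Defensive.

(** * Koszul complexes *)

Section Koszul.
Variables (R : comNzRingType) (V : lmodType R).
Implicit Types (xs : seq R) (M N : V -> Prop).

Definition submodule N : Prop :=
  N 0 /\ forall a u v, N u -> N v -> N (a *: u + v).

Lemma submoduleD N u v : submodule N -> N u -> N v -> N (u + v).
Proof. by case=> N0 Nlin Nu Nv; rewrite -[u]scale1r; apply: Nlin. Qed.

(* The Koszul complex, as the iterated mapping cone of the multiplications by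
   the elements of xs. *)
Fixpoint kos xs : lmodType R :=
  if xs is _ :: xs' then (kos xs' * kos xs')%type else V.

Arguments kos : simpl never.

Fixpoint kd xs : kos xs -> kos xs :=
  if xs is x :: xs' return kos xs -> kos xs
  then fun c => (kd c.1, x *: c.1 - kd c.2) else fun=> 0.

(* The cochains of degree s - 1 with values in N: the shift makes the zero
   module available as degree -1. *)
Fixpoint kmem N xs (s : nat) : kos xs -> Prop :=
  if xs is x :: xs' return kos xs -> Prop
  then fun c => kmem N s c.1 /\ kmem N s.-1 c.2
  else fun c => if s == 1%N then N c else c = 0.

Lemma kos_eq x xs (c c' : kos (x :: xs)) : c.1 = c'.1 -> c.2 = c'.2 -> c = c'.
Proof. by rewrite (surjective_pairing c) (surjective_pairing c') /= => -> ->. Qed.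

Lemma kd_linear xs : linear (@kd xs).
Proof.
elim: xs => [|x xs IHxs] a u v; first by rewrite /= scaler0 addr0.
apply: kos_eq; first exact: IHxs.
have -> : (kd (a *: u + v)).2 = x *: (a *: u.1 + v.1) - kd (a *: u.2 + v.2) by [].
rewrite IHxs scalerDr opprD addrACA scalerA mulrC -scalerA.
rewrite -scalerBr.
by rewrite [RHS]/=.
Qed.

HB.instance Definition _ xs :=
  GRing.isLinear.Build R (kos xs) (kos xs) *:%R (@kd xs) (@kd_linear xs).

Lemma kd_kd xs (c : kos xs) : kd (kd c) = 0.
Proof.
elim: xs c => [//|x xs IHxs] c.
apply: kos_eq; first exact: IHxs.
have -> : (kd (kd c)).2 = x *: kd c.1 - kd (x *: c.1 - kd c.2) by [].
by rewrite linearB linearZ /= IHxs subr0 subrr.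
Qed.

Section Membership.
Variables (N : V -> Prop) (subN : submodule N).

Lemma kmem0 xs s : kmem N s (0 : kos xs).
Proof. by elim: xs s => [|x xs IHxs] s //=; case: eqP => // _; case: subN. Qed.

Lemma kmem_lin xs s a (c c' : kos xs) :
  kmem N s c -> kmem N s c' -> kmem N s (a *: c + c').
Proof.
elim: xs s c c' => [|x xs IHxs] s c c' /=.
  by case: eqP => [_|_ -> ->]; [apply: subN.2 | rewrite scaler0 addr0].
by case=> c1 c2 [c1' c2']; split; apply: IHxs.
Qed.

Lemma kmemZ xs s a (c : kos xs) : kmem N s c -> kmem N s (a *: c).
Proof.
by move=> Nc; rewrite -[_ *: _]addr0; apply: kmem_lin => //; apply: kmem0.
Qed.

Lemma kmemD xs s (c c' : kos xs) :
  kmem N s c -> kmem N s c' -> kmem N s (c + c').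
Proof. by move=> Nc Nc'; rewrite -[c]scale1r; apply: kmem_lin. Qed.

Lemma kmemB xs s (c c' : kos xs) :
  kmem N s c -> kmem N s c' -> kmem N s (c - c').
Proof. by move=> Nc Nc'; rewrite -scaleN1r addrC; apply: kmem_lin. Qed.

Lemma kmem_eq0 xs (c : kos xs) : kmem N 0 c -> c = 0.
Proof.
elim: xs c => [|x xs IHxs] c //= [/IHxs c1 /IHxs c2].
exact: kos_eq.
Qed.

Lemma kmem_kd xs s (c : kos xs) : kmem N s c -> kmem N s.+1 (kd c).
Proof.
elim: xs s c => [|x xs IHxs] s c /=; first by move=> _; case: ifP => // _; case: subN.
case=> /[dup] c1 /IHxs dc1 c2; split=> //; apply: kmemB; first exact: kmemZ.
(* The truncation of [s.-1] matters only for [s = 0], where [c.2] is already zero. *)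
by case: s c2 {c1 dc1} => [/kmem_eq0->|s /IHxs//]; rewrite raddf0; apply: kmem0.
Qed.

End Membership.

Lemma kmem_sub M N xs s (c : kos xs) :
  (forall v, M v -> N v) -> kmem M s c -> kmem N s c.
Proof.
move=> sMN; elim: xs s c => [|x xs IHxs] s c /=; first by case: eqP => // _ /sMN.
by case=> c1 c2; split; apply: IHxs.
Qed.

Lemma kmem_scale f M N xs s (c : kos xs) :
  (forall v, M v -> N (f *: v)) -> kmem M s c -> kmem N s (f *: c).
Proof.
move=> fMN; elim: xs s c => [|x xs IHxs] s c /=.
  by case: eqP => [_ /fMN|_ ->]; rewrite ?scaler0.
by case=> c1 c2; split; apply: IHxs.
Qed.

(** Cochains with values in M/N are treated as M-cochains modulo N-cochains, so no quotient module
    is formed. A decomposition of the values lifts to cochains componentwise. *)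
Lemma kmem_split f M N N' xs s (c : kos xs) :
  (forall v, N' v -> exists a b, [/\ M a, N b & v = f *: a + b]) ->
  kmem N' s c -> exists a b, [/\ kmem M s a, kmem N s b & c = f *: a + b].
Proof.
move=> splitN'; elim: xs s c => [|x xs IHxs] s c /=.
  case: eqP => [_ /splitN'//|_ ->]; exists 0, 0; split=> //.
  by rewrite scaler0 addr0.
case=> /IHxs[a1 [b1 [Ma1 Nb1 e1]]] /IHxs[a2 [b2 [Ma2 Nb2 e2]]].
by exists (a1, a2), (b1, b2); split=> //; apply: kos_eq.
Qed.

Lemma kmem_nzd f M N xs s (c : kos xs) :
  (forall v, M v -> N (f *: v) -> N v) ->
  kmem M s c -> kmem N s (f *: c) -> kmem N s c.
Proof.
move=> nzd_f; elim: xs s c => [|x xs IHxs] s c /=.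
  by case: eqP => // _ /nzd_f.
by move=> [Mc1 Mc2] [Nc1 Nc2]; split; apply: IHxs.
Qed.

(** Contraction with the basis vector belonging to [x] is a null-homotopy of the multiplication by
    [x]. *)
Lemma kos_homotopy xs x : x \in xs ->
  exists h : kos xs -> kos xs,
    [/\ forall a c c', h (a *: c + c') = a *: h c + h c',
        forall c, x *: c = kd (h c) + h (kd c)
      & forall N, submodule N ->
          forall s c, kmem N s c -> kmem N s.-1 (h c)].
Proof.
elim: xs => // y xs IHxs; rewrite inE => /predU1P[-> | /IHxs[h [h_lin hE memh]]].
  exists (fun c : kos (y :: xs) => (c.2, 0) : kos (y :: xs)); split.
  - by move=> a c c'; apply: kos_eq => //; rewrite [RHS]/= scaler0 addr0.
  - move=> c; apply: kos_eq.
      by change (y *: c.1 = kd c.2 + (y *: c.1 - kd c.2)); rewrite addrC subrK.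
    change (y *: c.2 = y *: c.2 - kd (0 : kos xs) + 0).
    by rewrite raddf0 subr0 addr0.
  - by move=> N subN s c [_ Nc2]; split=> //; apply: kmem0.
have h0 : h 0 = 0 by have:= h_lin (- 1) 0 0; rewrite scaler0 addr0 scaleN1r addNr.
have hZ a c : h (a *: c) = a *: h c by have:= h_lin a c 0; rewrite h0 !addr0.
have hB c c' : h (c - c') = h c - h c'.
  by rewrite -scaleN1r addrC h_lin scaleN1r addrC.
(* The sign compensates for the one before [kd c.2] in the differential of the cone. *)
exists (fun c : kos (y :: xs) => (h c.1, - h c.2) : kos (y :: xs)); split.
- move=> a c c'; apply: kos_eq; first exact: h_lin.
  have -> : (a *: c + c').2 = a *: (c.2 : kos xs) + c'.2 by [].
  by rewrite [LHS]/= h_lin opprD -scalerN.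
- move=> c; apply: kos_eq; first exact: hE.
  change (x *: c.2 =
    (y *: h c.1 - kd (- h c.2)) + - h (y *: c.1 - kd c.2)).
  by rewrite hE hB hZ raddfN opprK opprB [RHS]addrC addrA subrK addrC.
move=> N subN s c [Nc1 Nc2]; split; first exact: memh.
by rewrite /= -scaleN1r; apply: kmemZ => //; apply: memh.
Qed.

(* f annihilates the Koszul cohomology of every M / N. *)
Definition kills xs f : Prop :=
  forall M N, submodule M -> submodule N -> forall s (c : kos xs),
    kmem M s c -> kmem N s.+1 (kd c) ->
    exists2 b, kmem M s.-1 b & kmem N s (f *: c - kd b).

Lemma kills_mem xs x : x \in xs -> kills xs x.
Proof.
move=> /kos_homotopy[h [_ hE memh]] M N subM subN s c Mc Ndc.
exists (h c); first exact: memh.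
by rewrite hE addrC addKr; apply: (memh N subN s.+1).
Qed.

(** This and the next two closure properties make [kills xs] an ideal; by [kills_mem] it contains
    the ideal generated by [xs]. *)
Lemma kills0 xs : kills xs 0.
Proof.
move=> M N subM subN s c _ _; exists 0; first exact: kmem0.
by rewrite scale0r raddf0 subr0; apply: kmem0.
Qed.

Lemma killsD xs f g : kills xs f -> kills xs g -> kills xs (f + g).
Proof.
move=> kf kg M N subM subN s c Mc Ndc.
have [b Mb fE] := kf M N subM subN s c Mc Ndc.
have [b' Mb' gE] := kg M N subM subN s c Mc Ndc.
exists (b + b'); first exact: kmemD.
by rewrite scalerDl raddfD opprD addrACA; apply: kmemD.
Qed.

Lemma killsM xs f g : kills xs g -> kills xs (f * g).
Proof.
move=> kg M N subM subN s c Mc Ndc.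
have [b Mb gE] := kg M N subM subN s c Mc Ndc.
exists (f *: b); first exact: kmemZ.
by rewrite linearZ -scalerA -scalerBr; apply: kmemZ.
Qed.

(* Vanishing of the Koszul cohomology of M / N in degree s - 1. *)
Definition kexact xs M N s : Prop :=
  forall c : kos xs, kmem M s c -> kmem N s.+1 (kd c) ->
    exists2 b, kmem M s.-1 b & kmem N s (c - kd b).

(** The embedding of V as the cochains of degree 0, which have index 1 in [kmem]. *)
Fixpoint kos_deg0 xs (u : V) : kos xs :=
  if xs is x :: xs' return kos xs then (kos_deg0 xs' u, 0) else u.

Lemma kmem_deg0 N xs u : submodule N -> N u -> kmem N 1 (kos_deg0 xs u).
Proof. by move=> subN Nu; elim: xs => //= x xs IHxs; split=> //; apply: kmem0. Qed.

Lemma deg0_kmem N xs u : kmem N 1 (kos_deg0 xs u) -> N u.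
Proof. by elim: xs => //= x xs IHxs [/IHxs]. Qed.

Lemma kos_deg0Z xs a u : kos_deg0 xs (a *: u) = a *: kos_deg0 xs u.
Proof.
elim: xs => // x xs IHxs; apply: kos_eq; first exact: IHxs.
by change (0 = a *: (0 : kos xs)); rewrite scaler0.
Qed.

(** On degree 0 the differential sends [u] to the family of all [x *: u], so a socle element modulo
    N is a cocycle modulo N. *)
Lemma kd_deg0 N xs u : submodule N -> (forall x, x \in xs -> N (x *: u)) ->
  kmem N 2 (kd (kos_deg0 xs u)).
Proof.
move=> subN; elim: xs => [|x xs IHxs] Nxu //=; split.
  by apply: IHxs => y xs_y; apply: Nxu; rewrite inE xs_y orbT.
rewrite raddf0 subr0 -kos_deg0Z; apply: kmem_deg0 => //.
by apply: Nxu; rewrite mem_head.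
Qed.

End Koszul.

(** * Regular sequences *)

Section RegularSequences.
Variables (k : fieldType) (n : nat).
Local Notation P := {mpoly k[n]}.
Variable V : lmodType P.
Implicit Types (M N : V -> Prop) (fs gs xs : seq P).

Lemma seq_mul_rcons fs f M v :
  seq_mul (rcons fs f) M v <-> exists a b, [/\ M a, seq_mul fs M b & v = f *: a + b].
Proof.
have sz : size (rcons fs f) = (size fs).+1 by rewrite size_rcons.
split=> [[w Mw ->]|[a [b [Ma [w Mw ->] ->]]]].
  pose w' i := w (cast_ord (esym sz) (widen_ord (leqnSn _) i)).
  exists (w (cast_ord (esym sz) ord_max)), (\sum_(i < size fs) fs`_i *: w' i).
  split=> //; first by exists w' => // i; apply: Mw.
  rewrite (reindex (cast_ord (esym sz))) /=; last first.
    by exists (cast_ord sz) => i _; rewrite ?cast_ordK ?cast_ordKV.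
  rewrite big_ord_recr /= addrC nth_rcons ltnn eqxx; congr (_ + _).
  by apply: eq_bigr => i _; rewrite nth_rcons ltn_ord.
(* The last index lies outside ['I_(size fs)], so there [insub] fails and the default [a] is
   taken. *)
exists (fun i : 'I_(size (rcons fs f)) => oapp w a (insub (val i))).
  by move=> i; case: insubP => [j _ _|_] /=; first exact: Mw.
rewrite (reindex (cast_ord (esym sz))) /=; last first.
  by exists (cast_ord sz) => i _; rewrite ?cast_ordK ?cast_ordKV.
rewrite big_ord_recr /= addrC nth_rcons ltnn eqxx insubF ?ltnn //=.
congr (_ + _); apply: eq_bigr => i _.
by rewrite nth_rcons ltn_ord; case: insubP => [j _ /val_inj->|]; rewrite ?ltn_ord.
Qed.

Lemma seq_mul_take fs j M v : (j < size fs)%N ->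
  seq_mul (take j.+1 fs) M v <->
  exists a b, [/\ M a, seq_mul (take j fs) M b & v = fs`_j *: a + b].
Proof. by move=> lt_j; rewrite (take_nth 0) //; apply: seq_mul_rcons. Qed.

Lemma submodule_seq_mul fs M : submodule M -> submodule (seq_mul fs M).
Proof.
move=> [M0 Mlin]; split.
  by exists (fun=> 0) => //; rewrite big1 // => i _; rewrite scaler0.
move=> a _ _ [u Mu ->] [v Mv ->]; exists (fun i => a *: u i + v i).
  by move=> i; apply: Mlin.
rewrite scaler_sumr -big_split; apply: eq_bigr => i _.
by rewrite scalerDr !scalerA mulrC.
Qed.

Lemma mem_seq_mul fs f M v : submodule M -> f \in fs -> M v ->
  seq_mul fs M (f *: v).
Proof.
move=> [M0 _] /[dup] fs_f; rewrite -index_mem => lt_f Mv.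
exists (fun i => if i == Ordinal lt_f then v else 0) => [i|]; first by case: eqP.
rewrite (bigD1 (Ordinal lt_f)) //= eqxx nth_index // big1 ?addr0 //.
by move=> i /negPf->; rewrite scaler0.
Qed.

Lemma seq_mul_ind fs M (Q : V -> Prop) :
  Q 0 -> (forall u v, Q u -> Q v -> Q (u + v)) ->
  (forall f v, f \in fs -> M v -> Q (f *: v)) ->
  forall v, seq_mul fs M v -> Q v.
Proof.
move=> Q0 QD Qf _ [w Mw ->]; apply: (big_ind Q) => // i _.
by apply: Qf => //; apply: mem_nth.
Qed.

(** Induction on the degree, for all quotients by initial segments of [fs] at once: since the next
    element [f] kills cohomology, [f *: c] is a coboundary [kd b] modulo N, and [b] is a cocycle of
    lower degree for the next quotient. *)
Lemma regular_kexact M fs xs : submodule M -> regular_seq M fs ->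
  (forall f, f \in fs -> kills V xs f) ->
  forall s j, (s + j <= size fs)%N -> kexact xs M (seq_mul (take j fs) M) s.
Proof.
move=> subM reg_fs kills_fs; elim=> [|s IHs] j.
  move=> _ c /kmem_eq0-> _; exists 0; first exact: kmem0.
  by rewrite raddf0 subr0; apply/kmem0/submodule_seq_mul.
rewrite addSnnS => le_sj c Mc Ndc.
have lt_j : (j < size fs)%N by apply: leq_trans le_sj; rewrite leq_addl.
have [_ _ nzd_f] := reg_fs j lt_j; set f := fs`_j in nzd_f.
set N := seq_mul (take j fs) M in Ndc nzd_f *.
have subN : submodule N by apply: submodule_seq_mul.
have splitN v := seq_mul_take M v lt_j.
have [b Mb Nfc] := kills_fs f (mem_nth _ lt_j) M N subM subN _ c Mc Ndc.
have Ndb : kmem (seq_mul (take j.+1 fs) M) s.+1 (kd b).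
  have -> : kd b = f *: c + (-1) *: (f *: c - kd b).
    by rewrite scaleN1r opprB addrC subrK.
  have subN' := submodule_seq_mul (take j.+1 fs) subM.
  apply: (kmemD subN').
    apply: kmem_scale Mc => v Mv; apply/splitN; exists v, 0.
    by rewrite addr0; split=> //; case: subN.
  apply: (kmemZ subN'); apply: kmem_sub Nfc => v Nv.
  by apply/splitN; exists 0, v; rewrite scaler0 add0r; split=> //; case: subM.
have [a Ma Nba] := IHs j.+1 le_sj b Mb Ndb.
have [b' [e [Mb' Ne bE]]] := kmem_split (fun v => (splitN v).1) Nba.
exists b' => //.
(* It suffices to prove the claim after multiplication by [f], which can be cancelled modulo N.
   Applying [kd] to [bE] removes [kd a]. *)
apply: (kmem_nzd (f := f) (M := M)); rewrite -/N //.
  exact: (kmemB subM Mc (kmem_kd subM Mb')).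
have -> : f *: (c - kd b') = (f *: c - kd b) + kd e.
  have -> : kd b = f *: kd b' + kd e.
    by rewrite -linearZ -raddfD /= -bE raddfB /= kd_kd subr0.
  by rewrite scalerBr opprD addrA subrK.
exact: (kmemD subN Nfc (kmem_kd subN Ne)).
Qed.

(* Along the exact sequences 0 -> M/N -> M/N -> M/(fM + N) -> 0 the class of u
   in degree 0 is lifted to a nonzero Koszul class of degree size fs of M. *)
Lemma regular_not_kexact M fs xs u : submodule M -> regular_seq M fs ->
  (forall f, f \in fs -> kills V xs f) ->
  M u -> ~ seq_mul fs M u -> (forall x, x \in xs -> seq_mul fs M (x *: u)) ->
  ~ kexact xs M (seq_mul [::] M) (size fs).+1.
Proof.
move=> subM reg_fs kills_fs Mu notNu Nxu.
(* Modulo the first [size fs - t] elements the cohomology is nonzero in degree [t]; [t = 0] is the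
   socle element, [t = size fs] the claim. *)
suff not_exact t : (t <= size fs)%N ->
    ~ kexact xs M (seq_mul (take (size fs - t) fs) M) t.+1.
  by have := not_exact _ (leqnn _); rewrite subnn take0.
elim: t => [_|t IHt lt_t] exN.
  rewrite subn0 take_size in exN.
  have subN := submodule_seq_mul fs subM.
  (* There are no coboundaries in degree 0, so exactness would put [u] into [seq_mul fs M]. *)
  have [b /kmem_eq0->] := exN _ (kmem_deg0 xs subM Mu) (kd_deg0 subN Nxu).
  by rewrite raddf0 subr0 => /deg0_kmem.
have IH := IHt (ltnW lt_t); apply: IH.
set j := (size fs - t.+1)%N in exN *.
have jE : (size fs - t = j.+1)%N by rewrite /j subnSK.
have lt_j : (j < size fs)%N by rewrite /j -subn_gt0 subKn.
rewrite jE => b Mb Ndb.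
have [_ _ nzd_f] := reg_fs j lt_j.
set f := fs`_j in nzd_f; set N := seq_mul (take j fs) M in nzd_f exN.
have subN : submodule N by apply: submodule_seq_mul.
have subN' := submodule_seq_mul (take j.+1 fs) subM.
have splitN v := seq_mul_take M v lt_j.
(* The class of [c] is the image of that of [b] under the connecting homomorphism. *)
have [c [e [Mc Ne dbE]]] := kmem_split (fun v => (splitN v).1) Ndb.
have Ndc : kmem N t.+3 (kd c).
  apply: (kmem_nzd nzd_f); first exact: kmem_kd.
  have /eqP : f *: kd c + kd e = 0 by rewrite -linearZ -raddfD /= -dbE kd_kd.
  rewrite addr_eq0 => /eqP->.
  by rewrite -scaleN1r; apply: kmemZ => //; apply: kmem_kd.
have [b' Mb' Ncb'] := exN c Mc Ndc.
(* Degree [t] is still in the vanishing range of M/N, so the connecting homomorphism is injective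
   there: once [c] is a coboundary modulo N, [b] is one modulo fM + N. *)
have exN_b : kexact xs M N t.+1.
  by apply: regular_kexact => //; rewrite addnC /j subnK.
have Mbb' : kmem M t.+1 (b - f *: b') by apply: kmemB => //; apply: kmemZ.
have [|a Ma Nba] := exN_b _ Mbb'.
  have -> : kd (b - f *: b') = f *: (c - kd b') + e.
    by rewrite linearB linearZ /= dbE scalerBr addrAC.
  by apply: (kmemD subN) => //; apply: kmemZ.
exists a => //.
have -> : b - kd a = f *: b' + (b - f *: b' - kd a).
  by rewrite addrA addrCA subrr addr0.
apply: (kmemD subN').
  apply: kmem_scale Mb' => v Mv; apply/splitN; exists v, 0.
  by rewrite addr0; split=> //; case: subN.
apply: kmem_sub Nba => v Nv; apply/splitN; exists 0, v.
by rewrite scaler0 add0r; split=> //; case: subM.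
Qed.

Lemma regular_seq_size_le M fs gs xs u : submodule M ->
  regular_seq M fs -> regular_seq M gs ->
  (forall f, f \in fs ++ gs -> kills V xs f) ->
  M u -> ~ seq_mul fs M u -> (forall x, x \in xs -> seq_mul fs M (x *: u)) ->
  (size gs <= size fs)%N.
Proof.
move=> subM reg_fs reg_gs kills_fg Mu notNu Nxu; rewrite leqNgt; apply/negP.
move=> lt_fg; apply: (regular_not_kexact subM reg_fs _ Mu notNu Nxu).
  by move=> f fs_f; apply: kills_fg; rewrite mem_cat fs_f.
(* The zero submodule is the quotient datum for the empty initial segment of [gs] as well as of
   [fs]. *)
rewrite -(take0 gs); apply: regular_kexact => //; last by rewrite addn0.
by move=> g gs_g; apply: kills_fg; rewrite mem_cat gs_g orbT.
Qed.

End RegularSequences.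

(** * Minima and maxima over finite sequences, and classes of exponents *)

Lemma bigminn_le (T : eqType) (r : seq T) (p : pred T) (F : T -> nat) x0 x :
  x \in r -> p x -> (\big[minn/x0]_(i <- r | p i) F i <= F x)%N.
Proof.
elim: r => // y r IHr; rewrite inE big_cons => /predU1P[<- -> | r_x px].
  exact: geq_minl.
by case: (p y); rewrite ?geq_min IHr ?orbT.
Qed.

Lemma bigminn_eq (T : eqType) (r : seq T) (p : pred T) (F : T -> nat) x0 :
  \big[minn/x0]_(i <- r | p i) F i = x0 \/
  exists x, [/\ x \in r, p x & \big[minn/x0]_(i <- r | p i) F i = F x].
Proof.
rewrite big_seq_cond.
elim/big_rec: _ => [|x m /andP[r_x px] IHm]; first by left.
by case: leqP => [_|_ //]; right; exists x.
Qed.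

Lemma exists_seq_max (T : eqType) (S : Type) (le : rel S) (F : T -> S) (s : seq T) :
  total le -> transitive le -> s != [::] ->
  exists2 x, x \in s & forall y, y \in s -> le (F y) (F x).
Proof.
move=> le_total le_trans; elim: s => // x s IHs _.
have le_refl z : le z z by have := le_total z z; rewrite orbb.
have [-> | /IHs[y s_y y_max]] := eqVneq s [::].
  by exists x => [|z]; rewrite inE ?eqxx // => /eqP->.
have [le_xy | nle_xy] := boolP (le (F x) (F y)).
  exists y => [|z]; first by rewrite inE s_y orbT.
  by rewrite inE => /predU1P[-> | /y_max].
have le_yx : le (F y) (F x) by have := le_total (F x) (F y); rewrite (negPf nle_xy).
exists x => [|z]; first exact: mem_head.
by rewrite inE => /predU1P[-> | /y_max/le_trans->].
Qed.

Section Classes.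
Variable n : nat.
Implicit Type m : 'X_{1..n}.

Lemma mcls_leP m (i : 'I_n) : m i != 0%N -> (mcls m <= i.+1)%N.
Proof. by move=> nz_mi; apply: bigminn_le => //; apply: mem_index_enum. Qed.

Lemma mcls_eq m : mcls m = n \/ exists2 i : 'I_n, m i != 0%N & mcls m = i.+1.
Proof.
rewrite /mcls.
have [|] := bigminn_eq (index_enum 'I_n) (fun i => m i != 0%N) (fun i => i.+1) n.
  by left.
case=> i [_ nz_mi ->].
by right; exists i.
Qed.

Lemma mcls_le m : (mcls m <= n)%N.
Proof. by have [->|[i _ ->]] := mcls_eq m; rewrite ?ltn_ord. Qed.

(** The bound [c < n] excludes the default class n of the exponent 0, which has no nonzero entry. *)
Lemma mcls_le_exists m c : (mcls m <= c)%N -> (c < n)%N ->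
  exists2 i : 'I_n, (i < c)%N & m i != 0%N.
Proof.
move=> le_mc lt_cn; have [mE|[i nz_mi mE]] := mcls_eq m.
  by rewrite ltnNge -{1}mE le_mc in lt_cn.
by exists i => //; rewrite -mE.
Qed.

End Classes.

(** * Leading exponents *)

Section LeadingExponents.
Variables (k : fieldType) (n : nat) (le : rel 'X_{1..n}).
Hypothesis le_order : term_order le.
Local Notation P := {mpoly k[n]}.
Implicit Types (p q : P) (m : 'X_{1..n}).

Lemma term_order_refl m : le m m.
Proof. by case: le_order => /(_ m m); rewrite orbb. Qed.

Lemma lexp_msupp p : p != 0 -> lexp le p \in msupp p.
Proof. by case/(lexpP le_order). Qed.

Lemma lexp_max p m : m \in msupp p -> le m (lexp le p).
Proof.
have [->|/(lexpP le_order)[_ p_max] /p_max//] := eqVneq p 0.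
by rewrite msupp0.
Qed.

Lemma lexp_eq p m :
  m \in msupp p -> {in msupp p, forall m', le m' m} -> lexp le p = m.
Proof.
move=> p_m m_max; case: le_order => _ le_anti _ _ _; apply: le_anti.
rewrite lexp_max // m_max // lexp_msupp //.
by apply: contraTneq p_m => ->; rewrite msupp0.
Qed.

Lemma term_order_add m1 m2 m3 m4 :
  le m1 m2 -> le m3 m4 -> le (m1 + m3)%MM (m2 + m4)%MM.
Proof.
case: le_order => _ _ le_trans le_add _ le12 le34.
apply: (le_trans (m2 + m3)%MM); first exact: le_add.
by rewrite ![(m2 + _)%MM]addmC; apply: le_add.
Qed.

(** By monotonicity [m2 + m3] lies between [m1 + m3] and [m2 + m4], which are equal; antisymmetry
    and cancellation do the rest. *)
Lemma term_order_add_eq m1 m2 m3 m4 : le m1 m2 -> le m3 m4 ->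
  (m1 + m3 = m2 + m4)%MM -> m1 = m2 /\ m3 = m4.
Proof.
case: (le_order) => _ le_anti _ _ _ le12 le34 eq_sum.
have eq34 : (m2 + m3 = m2 + m4)%MM.
  apply: le_anti; rewrite (term_order_add (term_order_refl _)) // -eq_sum.
  exact: (term_order_add le12 (term_order_refl _)).
have m34 : m3 = m4 by apply/eqP; rewrite -(eqm_add2l m2) eq34.
by split=> //; apply/eqP; rewrite -(eqm_add2r m3) eq_sum m34.
Qed.

Lemma msuppM_le_lexp p q m :
  m \in msupp (p * q) -> le m (lexp le p + lexp le q)%MM.
Proof.
by move=> /msuppM_le/allpairsP[[m1 m2] [/= p_m1 q_m2 ->]];
   apply: term_order_add; apply: lexp_max.
Qed.

Lemma mcoeffM_lexp p q : (p * q)@_(lexp le p + lexp le q)%MM =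
  p@_(lexp le p) * q@_(lexp le q).
Proof.
rewrite mcoeffM; set m := (_ + _)%MM.
have lt_p : (mdeg (lexp le p) < (mdeg m).+1)%N by rewrite ltnS mdegD leq_addr.
have lt_q : (mdeg (lexp le q) < (mdeg m).+1)%N by rewrite ltnS mdegD leq_addl.
(* Any other pair of exponents with the same sum has a member outside the support, by
   [term_order_add_eq]. *)
rewrite (bigD1 (BMultinom lt_p, BMultinom lt_q)) //= big1 ?addr0 // => -[m1 m2].
case/andP=> /= /eqP mE ne_m; apply/eqP; rewrite mulf_eq0 !mcoeff_eq0 -negb_and.
apply: contra ne_m => /andP[/lexp_max le1 /lexp_max le2].
have [eq1 eq2] := term_order_add_eq le1 le2 (esym mE).
by rewrite xpair_eqE !bmeqP /= eq1 eq2 !eqxx.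
Qed.

End LeadingExponents.

(** * Ideals generated by initial segments of the variables *)

Section VariableIdeals.
Variables (k : fieldType) (n : nat).
Local Notation P := {mpoly k[n]}.

Lemma first_varsE d : first_vars k n d = [seq 'X_i | i <- take d (enum 'I_n)].
Proof.
congr map; apply: (inj_map val_inj).
rewrite map_take -(filter_map val (fun i => i < d)%N) val_enum_ord take_iota.
have [le_dn | /ltnW le_nd] := leqP d n.
  rewrite -{1}(subnKC le_dn) iotaD filter_cat -[RHS]cats0.
  congr (_ ++ _).
    by apply/all_filterP/allP => i; rewrite mem_iota.
  rewrite (@eq_in_filter _ _ pred0) ?filter_pred0 // => i.
  by rewrite mem_iota add0n /= => /andP[le_di _]; rewrite ltnNge le_di.
apply/all_filterP/allP => i; rewrite mem_iota => /andP[_ lt_in].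
exact: leq_trans le_nd.
Qed.

Lemma size_first_vars d : (d <= n)%N -> size (first_vars k n d) = d.
Proof. by move=> le_dn; rewrite first_varsE size_map size_takel // size_enum_ord. Qed.

Lemma take_first_vars d i : (i <= d)%N ->
  take i (first_vars k n d) = first_vars k n i.
Proof. by move=> le_id; rewrite !first_varsE -map_take take_takel. Qed.

Lemma nth_first_vars d (i : 'I_n) : (i < d)%N -> (first_vars k n d)`_i = 'X_i.
Proof.
move=> lt_id; rewrite first_varsE (nth_map i) ?size_take_min ?leq_min.
  by rewrite nth_take // nth_ord_enum.
by rewrite size_enum_ord lt_id ltn_ord.
Qed.

Lemma mem_first_vars d (i : 'I_n) : (i < d)%N -> 'X_i \in first_vars k n d.
Proof. by move=> lt_id; apply: map_f; rewrite mem_filter lt_id mem_enum. Qed.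

Lemma first_varsP d f : f \in first_vars k n d ->
  exists2 i : 'I_n, (i < d)%N & f = 'X_i.
Proof. by case/mapP=> i; rewrite mem_filter => /andP[lt_id _] ->; exists i. Qed.

(* Membership in <x_1,...,x_d>, read off the monomials of p. *)
Definition in_vars d (p : P) : Prop :=
  forall m : 'X_{1..n}, m \in msupp p -> exists2 i : 'I_n, (i < d)%N & m i != 0%N.

Lemma in_vars0 d : in_vars d 0.
Proof. by move=> m; rewrite msupp0. Qed.

Lemma in_varsD d p q : in_vars d p -> in_vars d q -> in_vars d (p + q).
Proof.
by move=> dp dq m /msuppD_le; rewrite mem_cat => /orP[/dp|/dq].
Qed.

Lemma in_varsX d (i : 'I_n) p : (i < d)%N -> in_vars d ('X_i * p).
Proof.
move=> lt_id m /msuppM_le/allpairsP[[m1 m2] [/=]].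
rewrite msuppX inE => /eqP-> _ ->; exists i => //.
by rewrite mnmDE mnm1E eqxx.
Qed.

(** Each term of [p] is divisible by one of the first [d] variables, so [p] is a sum of multiples of
    them. *)
Lemma in_vars_ind d (Q : P -> Prop) :
  Q 0 -> (forall p q, Q p -> Q q -> Q (p + q)) ->
  (forall p (i : 'I_n), (i < d)%N -> Q (p * 'X_i)) ->
  forall p, in_vars d p -> Q p.
Proof.
move=> Q0 QD QX p dp; rewrite [p]mpolyE big_seq.
apply: (big_ind Q) => // m /dp[i lt_id nz_mi].
have /submK <- : (U_(i) <= m)%MM.
  by apply/mnm_lepP => j; rewrite mnm1E; case: eqP => // <-; rewrite lt0n.
by rewrite mpolyXD scalerAl; apply: QX.
Qed.

Lemma seq_mul_in_vars (I : P -> Prop) d p h :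
  is_ideal I -> in_vars d p -> I h ->
  seq_mul (V := P^o) (first_vars k n d) I (p * h).
Proof.
move=> [I0 ID IM] dp Ih.
have subI : submodule (V := P^o) I.
  by split=> // a u v Iu Iv; apply: ID => //; apply: IM.
have [N0 _] := submodule_seq_mul (first_vars k n d) subI.
move: p dp; apply: in_vars_ind => [|p q Np Nq|p i lt_id]; first by rewrite mul0r.
  by rewrite mulrDl; apply: (submoduleD (submodule_seq_mul _ subI)).
have -> : p * 'X_i * h = 'X_i *: (p * h : P^o) by rewrite [RHS]mulrCA mulrA.
by apply: mem_seq_mul => //; [apply: mem_first_vars | apply: IM].
Qed.

(** A homogeneous polynomial of positive degree has no constant term, so it lies in the ideal of all
    variables, whose elements kill the cohomology. *)
Lemma kills_homog (V : lmodType P) (f : P) :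
  f \is homog mdeg -> (1 < msize f)%N -> kills V (first_vars k n n) f.
Proof.
rewrite homog_msize => /dhomogP homf; case: (msize f) homf => [//|e] /= homf lt0e.
have: in_vars n f.
  move=> m /homf def_e.
  have /existsP[i nz_mi] : [exists i, m i != 0%N].
    apply: contraLR lt0e; rewrite negb_exists => /forallP m0.
    rewrite -leqNgt ltnS leqn0 -def_e mdeg_eq0; apply/eqP/mnmP => i.
    by rewrite mnm0E; apply/eqP; rewrite -[_ == _]negbK.
  by exists i.
move: {homf} f; apply: in_vars_ind => [|p q|p i lt_in].
- exact: kills0.
- exact: killsD.
- by apply/killsM/kills_mem/mem_first_vars.
Qed.

End VariableIdeals.

(** * Pommaret bases *)

Section StandardRepresentations.
Variables (k : fieldType) (n : nat) (le : rel 'X_{1..n}).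
Local Notation P := {mpoly k[n]}.
Variables (I : P -> Prop) (H : {fset P}).
Hypotheses (le_order : term_order le) (homI : homogeneous_ideal I).
Hypotheses (basisH : pommaret_basis le I H).
Hypothesis homH : forall h, h \in H -> h \is homog mdeg.
Implicit Types (R : P -> P) (h v : P) (m rho : 'X_{1..n}).

(** [R h] is the coefficient of [h], confined to the polynomial ring in the multiplicative variables
    of [h]. Values of [R] outside [H] are irrelevant. *)
Definition std_rep R : Prop := forall h rho (j : 'I_n),
  h \in H -> rho \in msupp (R h) -> (pcls le h < j.+1)%N -> rho j = 0%N.

Definition rep_val R : P := \sum_(h <- H) R h * h.

Lemma std_repD R R' : std_rep R -> std_rep R' -> std_rep (fun h => R h + R' h).
Proof.
move=> stdR stdR' h rho j Hh /msuppD_le; rewrite mem_cat.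
by case/orP; [apply: stdR | apply: stdR'].
Qed.

(** The first [min_cls le H] variables are multiplicative for every element of [H]. *)
Lemma std_repX (i : 'I_n) R : (i < min_cls le H)%N -> std_rep R ->
  std_rep (fun h => 'X_i * R h).
Proof.
move=> lt_id stdR h rho j Hh /msuppM_le/allpairsP[[m1 m2] [/=]].
rewrite msuppX inE => /eqP-> R_m2 -> lt_hj.
rewrite mnmDE mnm1E (stdR h m2 j) // addn0.
case: eqP => // eq_ij; move: lt_hj; rewrite -eq_ij ltnS leqNgt.
suff -> : (i < pcls le h)%N by [].
by apply: leq_trans lt_id _; apply: bigminn_le.
Qed.

Lemma rep_valD R R' : rep_val (fun h => R h + R' h) = rep_val R + rep_val R'.
Proof. by rewrite /rep_val -big_split; apply: eq_bigr => h _; rewrite mulrDl. Qed.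

Lemma rep_valM a R : rep_val (fun h => a * R h) = a * rep_val R.
Proof. by rewrite /rep_val mulr_sumr; apply: eq_bigr => h _; rewrite mulrA. Qed.

Lemma rep_val_delta p h : h \in H ->
  rep_val (fun g => if g == h then p else 0) = p * h.
Proof.
move=> Hh; rewrite /rep_val (bigD1_seq h) ?fset_uniq //= eqxx big1 ?addr0 // => g.
by move=> /negPf->; rewrite mul0r.
Qed.

Lemma pommaret_cone_std R h rho : std_rep R -> h \in H -> rho \in msupp (R h) ->
  pommaret_cone (lexp le h) (rho + lexp le h)%MM.
Proof.
move=> stdR Hh R_rho; exists rho; last by rewrite addmC.
by move=> j lt_hj; apply: stdR lt_hj.
Qed.

(* The leading exponents of the nonzero summands lie in disjoint cones, hence
   the largest of them cannot cancel. *)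
Lemma std_rep0 R : std_rep R -> rep_val R = 0 -> forall h, h \in H -> R h = 0.
Proof.
move=> stdR val0 h0 Hh0; apply/eqP; apply: contraT => nz0.
case: (le_order) => le_total le_anti le_trans _ _.
case: basisH => HI _ _ disjH.
pose mu h := (lexp le (R h) + lexp le h)%MM.
have [|h] := exists_seq_max (s := [seq h <- H | R h != 0]) mu le_total le_trans.
  by apply: contraTneq (Hh0) => eq_s; have := mem_filter (fun h => R h != 0) h0 H;
     rewrite eq_s nz0 => /= <-.
rewrite mem_filter => /andP[nz_Rh Hh] mu_max.
have nz_h : h != 0 by case: (HI h Hh).
have: (rep_val R)@_(mu h) != 0; last by rewrite val0 mcoeff0 eqxx.
rewrite /rep_val raddf_sum (bigD1_seq h) ?fset_uniq //= mcoeffM_lexp //.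
rewrite big_seq_cond big1 ?addr0 => [|g /andP[Hg ne_gh]].
  by rewrite mulf_neq0 // -mcoeff_msupp lexp_msupp.
apply/eqP; rewrite mcoeff_eq0; apply: contra ne_gh => supp_g.
have nz_Rg : R g != 0.
  by apply: contraTneq supp_g => ->; rewrite mul0r msupp0.
have eq_mu : mu h = mu g.
  apply: le_anti; rewrite msuppM_le_lexp //.
  by apply: mu_max; rewrite mem_filter nz_Rg.
have coneh := pommaret_cone_std stdR Hh (lexp_msupp le_order nz_Rh).
have coneg := pommaret_cone_std stdR Hg (lexp_msupp le_order nz_Rg).
by apply/eqP/(disjH _ _ (mu h)) => //; rewrite eq_mu.
Qed.

Lemma std_rep_inj R R' : std_rep R -> std_rep R' -> rep_val R = rep_val R' ->
  forall h, h \in H -> R h = R' h.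
Proof.
move=> stdR stdR' eqR h Hh; apply/eqP; rewrite -subr_eq0; apply/eqP.
apply: (std_rep0 (R := fun h => R h - R' h)) => //.
  by move=> g rho j Hg /msuppB_le; rewrite mem_cat => /orP[/stdR|/stdR']; apply.
by rewrite /rep_val -[RHS](subrr (rep_val R)) {2}eqR /rep_val -sumrB;
   apply: eq_bigr => g _; rewrite mulrBl.
Qed.

(** Division by the element of [H] whose cone contains the leading exponent of [v]. The final bound
    on exponents is what later brings in the class respecting order. *)
Lemma std_rep_homog e v : I v -> v \is e.-homog for mdeg ->
  exists R, [/\ std_rep R, v = rep_val R &
    forall h rho, h \in H -> rho \in msupp (R h) ->
      mdeg (rho + lexp le h) = e /\ le (rho + lexp le h)%MM (lexp le v)].
Proof.
(* The measure of termination: fixing the degree leaves finitely many exponents, so no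
   well-foundedness of [le] has to be shown. *)
pose below v := [set m : 'X_{1..n < e.+1} | le m (lexp le v)].
case: (le_order) => _ le_anti le_trans _ le0.
case: (homI) => -[I0 ID IM] _; case: basisH => HI _ lexpI _.
have [N] := ubnP #|below v|; elim: N v => // N IHN v.
move=> lt_vN Iv /[dup] homv /dhomogP degv.
have [v0 | nz_v] := eqVneq v 0.
  exists (fun=> 0); split=> [h rho j _||h rho _]; rewrite ?msupp0 //.
  by rewrite v0 /rep_val big1 // => h _; rewrite mul0r.
have [h Hh [rho std_rho vE]] :=
  (lexpI (lexp le v)).1 (ex_intro _ v (And3 Iv nz_v erefl)).
have [Ih nz_h] := HI h Hh.
have supp_v := lexp_msupp le_order nz_v.
have supp_h := lexp_msupp le_order nz_h.
have deg_vE : mdeg (rho + lexp le h) = e by rewrite addmC -vE degv.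
pose c := v@_(lexp le v) / h@_(lexp le h).
pose p := c *: 'X_[rho] : P; pose v' := v - p * h.
have supp_p m : m \in msupp p -> m = rho.
  by move/msuppZ_le; rewrite msuppX inE => /eqP.
have coef_v' : v'@_(lexp le v) = 0.
  rewrite mcoeffB /p -scalerAl mcoeffZ [_ * h]mulrC {2}vE addmC mcoeffMX.
  by rewrite /c mulfVK ?subrr // -mcoeff_msupp.
have le_v' m : m \in msupp v' -> mdeg m = e /\ le m (lexp le v).
  move/msuppB_le; rewrite mem_cat => /orP[v_m | /msuppM_le/allpairsP[[m1 m2] [/=]]].
    by rewrite degv //; split=> //; apply: lexp_max.
  move=> /supp_p-> h_m2 ->; rewrite vE addmC; split; last first.
    by apply: term_order_add; rewrite ?lexp_max ?term_order_refl.
  have /homogP[e' /dhomogP degh] := homH Hh.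
  by rewrite mdegD (degh m2) // -deg_vE mdegD (degh _ supp_h) addnC.
have Iv' : I v'.
  by apply: ID => //; rewrite -mulNr; apply: IM.
have homv' : v' \is e.-homog for mdeg by apply/dhomogP => ? /le_v'[].
have le_lexp' : le (lexp le v') (lexp le v).
  have [->|nz_v'] := eqVneq v' 0; last by case: (le_v' _ (lexp_msupp le_order nz_v')).
  by rewrite /lexp msupp0.
pose R0 g : P := if g == h then p else 0.
have stdR0 : std_rep R0.
  move=> g m j Hg; rewrite /R0; case: eqP => [->|_]; last by rewrite msupp0.
  by move/supp_p=> ->; apply: std_rho.
have [v'0 | nz_v'] := eqVneq v' 0.
  exists R0; split=> // [|g m Hg].
    by apply/eqP; rewrite rep_val_delta // -subr_eq0; apply/eqP.
  rewrite /R0; case: eqP => [->|_]; last by rewrite msupp0.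
  by move/supp_p=> ->; split=> //; rewrite vE addmC term_order_refl.
(* The leading exponent of [v] is in [below v] but not in [below v'], its coefficient having been
   cancelled. *)
have lt_v'N : (#|below v'| < N)%N.
  apply: leq_trans (proper_card _) lt_vN; apply/properP; split.
    by apply/subsetP => m; rewrite !inE => /le_trans; apply.
  have lt_e : (mdeg (lexp le v) < e.+1)%N by rewrite degv.
  exists (BMultinom lt_e); rewrite inE ?term_order_refl //=.
  apply: contraNN nz_v' => le_vv'.
  have eq_lexp : lexp le v' = lexp le v by apply: le_anti; rewrite le_lexp'.
  rewrite -[v' == 0]negbK; apply/negP => /(lexp_msupp le_order).
  by rewrite eq_lexp mcoeff_msupp coef_v' eqxx.
have [R [stdR v'E boundR]] := IHN v' lt_v'N Iv' homv'.
exists (fun g => R0 g + R g); split=> [||g m Hg /msuppD_le]; first exact: std_repD.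
  by rewrite rep_valD rep_val_delta // -v'E addrC subrK.
rewrite mem_cat => /orP[|/boundR[] // -> le_m]; last first.
  by split=> //; apply: le_trans le_lexp'.
rewrite /R0; case: eqP => [->|_]; last by rewrite msupp0.
by move/supp_p=> ->; split=> //; rewrite vE addmC term_order_refl.
Qed.

Lemma std_rep_exists v : I v -> exists2 R, std_rep R & v = rep_val R.
Proof.
move=> Iv; rewrite (pihomog_partitionE (leqnn (msize v))).
apply: (big_ind (fun v => exists2 R, std_rep R & v = rep_val R)).
- exists (fun=> 0) => [h rho j _|]; first by rewrite msupp0.
  by rewrite /rep_val big1 // => h _; rewrite mul0r.
- move=> _ _ [R stdR ->] [R' stdR' ->]; exists (fun h => R h + R' h).
    exact: std_repD.
  by rewrite rep_valD.
move=> e _; have [|R [stdR vE _]] := std_rep_homog _ (pihomogP mdeg e v).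
  by case: homI => _; apply.
by exists R.
Qed.

(** * Regularity of the first variables *)

Lemma min_cls_le : (min_cls le H <= n)%N.
Proof.
rewrite /min_cls; have [->//|[h [_ _ ->]]] := bigminn_eq H predT (pcls le) n.
exact: mcls_le.
Qed.

Lemma min_cls_leP h : h \in H -> (min_cls le H <= pcls le h)%N.
Proof. by move=> Hh; apply: bigminn_le. Qed.

Let subI : submodule (V := P^o) I.
Proof.
by case: homI => -[I0 ID IM] _; split=> // a u v Iu Iv; apply: ID => //; apply: IM.
Qed.

(** Multiplication by one of the first [j] variables acts on the coefficients and keeps a
    representation standard, so membership in the submodule is visible on coefficients;
    [rep_seq_mul] is the converse. *)
Lemma seq_mul_rep j v : (j <= min_cls le H)%N ->
  seq_mul (V := P^o) (first_vars k n j) I v ->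
  exists R, [/\ std_rep R, v = rep_val R & forall h, h \in H -> in_vars j (R h)].
Proof.
move=> le_jd; move: v; apply: (seq_mul_ind (V := P^o)) => [|u v|f v /first_varsP[i lt_ij ->]].
- exists (fun=> 0); split=> [h rho i _||h _]; rewrite ?msupp0 //.
    by rewrite /rep_val big1 // => h _; rewrite mul0r.
  exact: in_vars0.
- move=> [R [stdR -> varR]] [R' [stdR' -> varR']].
  exists (fun h => R h + R' h); split; first exact: std_repD.
    by rewrite rep_valD.
  by move=> h Hh; apply: in_varsD; [apply: varR | apply: varR'].
move=> /std_rep_exists[R stdR ->]; exists (fun h => 'X_i * R h); split.
- by apply: std_repX => //; apply: leq_trans lt_ij le_jd.
- by rewrite rep_valM.
- by move=> h _; apply: in_varsX.
Qed.

Lemma rep_seq_mul j R : (forall h, h \in H -> in_vars j (R h)) ->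
  seq_mul (V := P^o) (first_vars k n j) I (rep_val R).
Proof.
move=> varR; have subN := submodule_seq_mul (first_vars k n j) subI.
rewrite /rep_val big_seq; apply: (big_ind (seq_mul (V := P^o) _ I)).
- by case: subN.
- by move=> u v; apply: (submoduleD subN).
move=> h Hh; case: basisH => HI _ _ _; apply: seq_mul_in_vars; last by case: (HI h Hh).
  by case: homI.
exact: varR.
Qed.

Lemma regular_first_vars :
  regular_seq (V := P^o) I (first_vars k n (min_cls le H)).
Proof.
move=> i; rewrite size_first_vars ?min_cls_le // => lt_id.
have lt_in : (i < n)%N by apply: leq_trans min_cls_le.
rewrite -[i]/(val (Ordinal lt_in)) nth_first_vars //; split.
- by apply/homogP; exists 1%N; rewrite dhomogX; apply/eqP/mdeg1.
- by rewrite msizeX mdeg1.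
rewrite /= take_first_vars; last exact: ltnW.
move=> v Iv /(seq_mul_rep (ltnW lt_id))[R [stdR xvE varR]].
have [R' stdR' vE] := std_rep_exists Iv.
rewrite vE; apply: rep_seq_mul => h Hh m R'_m.
set x := 'X_(Ordinal lt_in) in xvE.
have xR'E : x * R' h = R h.
  apply: (std_rep_inj (R := fun g => x * R' g)) Hh => //; first exact: std_repX.
  by rewrite rep_valM -vE -xvE.
(* A monomial [m] of [R' h] times the variable occurs in [R h], so an earlier variable divides the
   product and hence [m]. *)
have [|l lt_li nz_l] := varR h Hh (m + U_(Ordinal lt_in))%MM.
  rewrite -xR'E mcoeff_msupp mulrC /x [(m + _)%MM]addmC mcoeffMX.
  by rewrite -mcoeff_msupp.
exists l => //; move: nz_l; rewrite mnmDE mnm1E.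
have [eq_il|_] := eqVneq (Ordinal lt_in) l; first by rewrite -eq_il ltnn in lt_li.
by rewrite addn0.
Qed.

(** The unique standard representation of [h] has coefficient 1 at [h], which is not in the ideal of
    the variables. *)
Lemma not_seq_mul_basis h : h \in H ->
  ~ seq_mul (V := P^o) (first_vars k n (min_cls le H)) I h.
Proof.
move=> Hh /(seq_mul_rep (leqnn _))[R [stdR hE varR]].
pose R0 g : P := if g == h then 1 else 0.
have stdR0 : std_rep R0.
  move=> g rho j _; rewrite /R0; case: eqP => _; last by rewrite msupp0.
  by rewrite msupp1 inE => /eqP->; rewrite mnm0E.
have RhE : R0 h = R h.
  apply: (std_rep_inj stdR0 stdR _ Hh).
  by rewrite (rep_val_delta 1 Hh) mul1r.
have [|l _] := varR h Hh 0%MM; last by rewrite mnm0E.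
by rewrite -RhE /R0 eqxx msupp1 mem_head.
Qed.

(** * A socle element and the bound on the length of regular sequences *)

Hypothesis le_cls : class_respecting le.

Lemma seq_mul_socle h0 (i : 'I_n) : h0 \in H -> pcls le h0 = min_cls le H ->
  (forall h, h \in H -> pcls le h = min_cls le H ->
    (mdeg (lexp le h) <= mdeg (lexp le h0))%N) ->
  seq_mul (V := P^o) (first_vars k n (min_cls le H)) I ('X_i * h0).
Proof.
move=> Hh0 cls_h0 max_h0; set d := min_cls le H in cls_h0 max_h0 *.
case: (homI) => -[I0 ID IM] _; case: (basisH) => HI _ _ _.
have [Ih0 nz_h0] := HI h0 Hh0.
have [lt_id | le_di] := ltnP i d.
  exact: (mem_seq_mul (V := P^o) subI (mem_first_vars k lt_id) Ih0).
have lt_dn : (d < n)%N by apply: leq_ltn_trans (ltn_ord i).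
case: (le_order) => _ le_anti _ _ _.
have /homogP[e homh0] := homH Hh0.
have deg_h0 : mdeg (lexp le h0) = e.
  by move/dhomogP: homh0; apply; apply: lexp_msupp.
have homv : 'X_i * h0 \is (1 + e).-homog for mdeg.
  by apply: dhomogM => //; rewrite dhomogX; apply/eqP/mdeg1.
have [R [stdR vE boundR]] := std_rep_homog (IM _ _ Ih0) homv.
rewrite vE; apply: rep_seq_mul => h Hh rho R_rho.
have [deg_rho le_rho] := boundR h rho Hh R_rho.
have lexp_v : lexp le ('X_i * h0) = (U_(i) + lexp le h0)%MM.
  have lexp_X : lexp le ('X_i : P) = U_(i)%MM.
    apply: lexp_eq => [//||m]; first by rewrite msuppX mem_head.
    by rewrite msuppX inE => /eqP->; apply: term_order_refl.
  apply: lexp_eq => // [|m /(msuppM_le_lexp le_order)]; last first.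
    by rewrite lexp_X.
  have := mcoeffM_lexp le_order 'X_i h0; rewrite lexp_X mcoeff_msupp => ->.
  rewrite mulf_neq0 // -mcoeff_msupp; last exact: lexp_msupp.
  by rewrite msuppX mem_head.
have cls_v : (mcls (U_(i) + lexp le h0)%MM <= d)%N.
  have [h0E|[l nz_l h0E]] := mcls_eq (lexp le h0).
    by rewrite -cls_h0 /pcls h0E ltnn in lt_dn.
  rewrite -cls_h0 /pcls h0E; apply: mcls_leP.
  by rewrite mnmDE addn_eq0 negb_and nz_l orbT.
(* A larger class in the same degree would make this exponent exceed the leading one. *)
have cls_rho : (mcls (rho + lexp le h)%MM <= d)%N.
  rewrite leqNgt; apply/negP => lt_d.
  have /andP[ne_v le_v] : term_lt le (U_(i) + lexp le h0)%MM (rho + lexp le h)%MM.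
    apply: le_cls; last exact: leq_ltn_trans lt_d.
    by rewrite mdegD mdeg1 deg_h0 deg_rho.
  by case/eqP: ne_v; apply: le_anti; rewrite le_v -lexp_v.
(* If the class of [h] exceeds [d], its leading exponent has no entry among the first [d] variables,
   so the one found in the sum comes from [rho]. *)
have [eq_cls | ne_cls] := eqVneq (pcls le h) d; last first.
  have [l lt_ld nz_l] := mcls_le_exists cls_rho lt_dn; exists l => //.
  move: nz_l; rewrite mnmDE; have [-> //|nz_h] := eqVneq (lexp le h l) 0%N.
    by rewrite addn0.
  have lt_dh : (d < pcls le h)%N by rewrite ltn_neqAle eq_sym ne_cls min_cls_leP.
  by have := leq_trans lt_dh (mcls_leP nz_h); rewrite ltnS leqNgt lt_ld.
(* For [h] of class [d], [rho = 0] would give [h] degree [e.+1], above the maximum [e]. A nonzero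
   [rho] involves only the first [d] variables by standardness. *)
have /existsP[l nz_l] : [exists l, rho l != 0%N].
  apply: contraT; rewrite negb_exists => /forallP rho0.
  have rhoE : rho = 0%MM.
    by apply/mnmP => l; rewrite mnm0E; apply/eqP; rewrite -[_ == _]negbK.
  have := max_h0 h Hh eq_cls; rewrite deg_h0 -ltnS -[e.+1]add1n -deg_rho rhoE.
  by rewrite add0m ltnn.
exists l => //; rewrite ltnNge; apply: contra nz_l => le_dl.
by apply/eqP/(stdR h) => //; rewrite eq_cls.
Qed.

Lemma regular_seq_size_le_min_cls gs : (exists2 f, I f & f != 0) ->
  regular_seq (V := P^o) I gs -> (size gs <= min_cls le H)%N.
Proof.
move=> [f If nz_f] reg_gs; set d := min_cls le H.
case: (basisH) => HI _ lexpI _.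
have [h Hh _] := (lexpI (lexp le f)).1 (ex_intro _ f (And3 If nz_f erefl)).
have [h1 Hh1 cls_h1] : exists2 h, h \in H & pcls le h = d.
  (* If the minimum is the default n, every element of [H] has class n, and [H] is nonempty because
     I is nonzero. *)
  have [dE|[h1 [Hh1 _ dE]]] := bigminn_eq H predT (pcls le) n; last by exists h1.
  exists h => //; apply/eqP; rewrite eqn_leq min_cls_leP // andbT.
  by rewrite /d /min_cls dE mcls_le.
have [|h0] := exists_seq_max (s := [seq h <- H | pcls le h == d])
  (fun h => mdeg (lexp le h)) leq_total (@leq_trans).
  apply: contraTneq Hh1 => eq_s.
  by have := mem_filter (fun h => pcls le h == d) h1 H;
     rewrite eq_s cls_h1 eqxx /= => <-.
rewrite mem_filter => /andP[/eqP cls_h0 Hh0] max_h0.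
have [Ih0 _] := HI h0 Hh0.
rewrite -[d](size_first_vars k min_cls_le).
have kill fs : regular_seq (V := P^o) I fs ->
    forall g, g \in fs -> kills P^o (first_vars k n n) g.
  move=> reg_fs g /(nthP 0)[i lt_i <-]; have [homg deg_g _] := reg_fs i lt_i.
  exact: kills_homog.
apply: (regular_seq_size_le (V := P^o) (xs := first_vars k n n) subI
  regular_first_vars reg_gs _ Ih0 (not_seq_mul_basis Hh0)).
  move=> g; rewrite mem_cat => /orP[]; [exact: kill regular_first_vars g|].
  exact: kill reg_gs g.
move=> _ /first_varsP[i _ ->]; apply: seq_mul_socle => // g Hg cls_g.
by apply: max_h0; rewrite mem_filter cls_g eqxx.
Qed.

End StandardRepresentations.

Unset Implicit Arguments.

Theorem proposition2p19 (k : fieldType) (n : nat) (le : rel 'X_{1..n})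
    (I : {mpoly k[n]} -> Prop) (H : {fset {mpoly k[n]}}) :
  term_order le ->
  class_respecting le ->
  homogeneous_ideal I ->
  (exists2 f, I f & f != 0) ->
  pommaret_basis le I H ->
  (forall h, h \in H -> h \is homog mdeg) ->
  let d := min_cls le H in
  maximal_regular_seq (V := {mpoly k[n]}^o) I (first_vars k n d) /\
  has_depth (V := {mpoly k[n]}^o) I d.
Proof.
move=> le_order le_cls homI nzI basisH homH d.
have reg_x := regular_first_vars le_order homI basisH homH.
have size_le gs := @regular_seq_size_le_min_cls _ _ _ _ _
  le_order homI basisH homH le_cls gs nzI.
have size_x : size (first_vars k n d) = d by apply/size_first_vars/min_cls_le.
split; split=> //.
  (* The length bound leaves no room for [gs], and it also bounds the depth. *)
  move=> gs /size_le; rewrite size_cat size_x -[X in (_ <= X)%N]addn0 leq_add2l.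
  by case: gs.
by exists (first_vars k n d).
Qed.
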